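(* Let $p,q\ge1$, let $\vec w_1=(w_{1,1},\ldots,w_{1,p})$ and $\vec w_2=(w_{2,1},\ldots,w_{2,q})$ be two vectors of weights on $\mathbb R$, and let $\vec n=(n_1,\ldots,n_p)$, $\vec m=(m_1,\ldots,m_q)$ be multi-indices of positive integers with $|\vec n|=|\vec m|=n$. Suppose that $F_{\vec n}$ and $G_{\vec m}$ are both $n$-dimensional subspaces of $L^2(\mathbb R)$ and that $F_{\vec n}\cap G_{\vec m}^{\perp}=\{0\}$. Let $\phi_1,\ldots,\phi_n$ and $\psi_1,\ldots,\psi_n$ be biorthogonal bases of $F_{\vec n}$ and $G_{\vec m}$, and let $K(x,y)=\sum_{j=1}^n\phi_j(x)\psi_j(y)$. Then $$(x-y)K(x,y)=\sum_{j=1}^{p}Q^{(II,j)}_{\vec n+\vec e_j,\vec m}(x;\vec w_1,\vec w_2)\,Q^{(I,j)}_{\vec m,\vec n-\vec e_j}(y;\vec w_2,\vec w_1)-\sum_{k=1}^{q}Q^{(I,k)}_{\vec n,\vec m-\vec e_k}(x;\vec w_1,\vec w_2)\,Q^{(II,k)}_{\vec m+\vec e_k,\vec n}(y;\vec w_2,\vec w_1).$$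
   Context: A weight on $\mathbb R$ is a function $w$ with $w(x)\ge 0$ for $x\in\mathbb R$ and $\int x^k w(x)\,dx<+\infty$ for every integer $k\ge 0$. $|\vec n|=\sum_i n_i$; $\vec e_k$ is the $k$th standard basis vector (of the appropriate length). Standing assumption: $x^jw_{1,k}\in L^2(\mathbb R)$ for $0\le j\le n_k$, $k=1,\ldots,p$, and $x^jw_{2,k}\in L^2(\mathbb R)$ for $0\le j\le m_k$, $k=1,\ldots,q$. $F_{\vec n}=\{\sum_{j=1}^pA_jw_{1,j}\mid A_j\text{ polynomial of degree}\le n_j-1\}$ and $G_{\vec m}=\{\sum_{j=1}^qB_jw_{2,j}\mid B_j\text{ polynomial of degree}\le m_j-1\}$; $\perp$ is the orthogonal complement in $L^2(\mathbb R)$. Bases $\phi_1,\ldots,\phi_n$ of $F_{\vec n}$ and $\psi_1,\ldots,\psi_n$ of $G_{\vec m}$ are biorthogonal if $\int\phi_j(x)\psi_k(x)\,dx=\delta_{j,k}$; such bases exist under the stated hypotheses, and $K$ does not depend on their choice. Mixed type forms: let $\vec u=(u_1,\ldots,u_r)$ and $\vec v=(v_1,\ldots,v_s)$ be vectors of weights, and $\vec\nu$ (length $r$), $\vec\mu$ (length $s$) multi-indices with $|\vec\nu|=|\vec\mu|+1$. Polynomials $A_1,\ldots,A_r$ with $\deg A_j\le\nu_j-1$ are multiple orthogonal polynomials of mixed type for $(\vec\nu,\vec\mu)$ with respect to $(\vec u,\vec v)$ if $Q=\sum_{j=1}^rA_ju_j$ satisfies $\int Q(x)x^jv_k(x)\,dx=0$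 for $j=0,\ldots,\mu_k-1$, $k=1,\ldots,s$. $Q^{(I,k)}_{\vec\nu,\vec\mu}(x;\vec u,\vec v)$, $k\in\{1,\ldots,s\}$, is the form normalized by $\int Q(x)x^{\mu_k}v_k(x)\,dx=1$ (type I normalization); $Q^{(II,k)}_{\vec\nu,\vec\mu}(x;\vec u,\vec v)$, $k\in\{1,\ldots,r\}$, is the form normalized so that $A_k$ is monic of degree $\nu_k-1$ (type II normalization). These are used both with $(\vec u,\vec v)=(\vec w_1,\vec w_2)$ and with $(\vec u,\vec v)=(\vec w_2,\vec w_1)$; under the hypotheses of the claim all forms appearing there exist and are unique. *)

(* Defs.v *)
From HB Require Import structures.
From mathcomp Require Import all_boot all_order all_algebra.
From mathcomp Require Import all_classical all_reals all_analysis.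

Set Implicit Arguments.
Unset Strict Implicit.
Unset Printing Implicit Defensive.

Import Order.TTheory GRing.Theory Num.Theory.
Import numFieldNormedType.Exports.

Local Open Scope classical_set_scope.
Local Open Scope ring_scope.

(* The completed measure is used so that "measurable" means Lebesgue measurable
   rather than Borel; the carrier of its sigma-algebra is convertible to R. *)
Notation leb R := (@completed_lebesgue_measure R).

Section L2.
Context {R : realType}.
Implicit Types (f g w : R -> R) (S : set (R -> R)).

(* Integrability of w itself (k = 0) contains its measurability. *)
Definition weight w : Prop :=
  (forall x, 0 <= w x) /\
  (forall k : nat, (leb R).-integrable setT (fun x : R => (x ^+ k * w x)%:E)).

Definition L2 : set (R -> R) := [set f | f \in Lfun (leb R) 2%:E].

(* Elements of L2 are kept as functions; equality in L^2(R) is this relation. *)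
Definition L2eq f g : Prop := {ae (leb R), forall x : R, f x = g x}.

Definition pairing f g : \bar R := (\int[leb R]_x (f x * g x)%:E)%E.

Definition perp S : set (R -> R) :=
  [set f | L2 f /\ forall g, S g -> pairing f g = 0%E].

Definition lincomb n (c : 'I_n -> R) (b : 'I_n -> R -> R) : R -> R :=
  fun x => \sum_(i < n) c i * b i x.

Definition L2basis S n (b : 'I_n -> R -> R) : Prop :=
  [/\ forall i, S (b i),
      forall c, L2eq (lincomb c b) (fun=> 0) -> forall i, c i = 0
    & forall f, S f -> exists c, L2eq f (lincomb c b)].

Definition L2dim S n : Prop :=
  S `<=` L2 /\ exists b : 'I_n -> R -> R, L2basis S b.

Definition biorthogonal n (phi psi : 'I_n -> R -> R) : Prop :=
  forall j k, pairing (phi j) (psi k) = ((j == k)%:R : R)%:E.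

End L2.

Section MultiIndex.
Context {r : nat}.
Implicit Types nu : 'I_r -> nat.

Definition mi_size nu : nat := (\sum_(i < r) nu i)%N.

Definition mi_incr nu (k : 'I_r) : 'I_r -> nat := fun i => (nu i + (i == k))%N.

Definition mi_decr nu (k : 'I_r) : 'I_r -> nat := fun i => (nu i - (i == k))%N.

End MultiIndex.

Section Forms.
Context {R : realType}.

Definition form r (A : 'I_r -> {poly R}) (u : 'I_r -> R -> R) : R -> R :=
  fun x => \sum_(j < r) (A j).[x] * u j x.

(* F_n for (w_1, n), and G_m for (w_2, m); size is the degree plus one, so an
   index nu j = 0 forces A j = 0. *)
Definition form_space r (u : 'I_r -> R -> R) (nu : 'I_r -> nat) :
    set (R -> R) :=
  [set form A u | A in [set A : 'I_r -> {poly R} | forall j, (size (A j) <= nu j)%N]].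

Section Mixed.
Context {r s : nat}.
Variables (u : 'I_r -> R -> R) (v : 'I_s -> R -> R).
Variables (nu : 'I_r -> nat) (mu : 'I_s -> nat).

Definition mixed_type (A : 'I_r -> {poly R}) : Prop :=
  [/\ mi_size nu = (mi_size mu + 1)%N,
      forall j, (size (A j) <= nu j)%N
    & forall (k : 'I_s) (j : nat), (j < mu k)%N ->
        pairing (form A u) (fun x => x ^+ j * v k x) = 0%E].

Definition type_I (k : 'I_s) : set ('I_r -> {poly R}) :=
  [set A | mixed_type A /\
           pairing (form A u) (fun x => x ^+ mu k * v k x) = 1%E].

Definition type_II (k : 'I_r) : set ('I_r -> {poly R}) :=
  [set A | [/\ mixed_type A, A k \is monic & size (A k) = nu k]].

(* The definite descriptions Q^(I,k) and Q^(II,k): xget picks an element of the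
   set, with junk value 0 when the set is empty. *)
Definition Q_I (k : 'I_s) : R -> R := form (xget (fun=> 0) (type_I k)) u.

Definition Q_II (k : 'I_r) : R -> R := form (xget (fun=> 0) (type_II k)) u.

End Mixed.
End Forms.

(* Main.v *)
(* Write phi_i = sum_l A_il u_l and psi_i = sum_l B_il v_l. Since there are
   exactly |nu| = n of the phi_i, biorthogonality forces every tuple of
   polynomials P with deg P_l < nu_l to expand as
   P = sum_i <form P, psi_i> A_i, as polynomials and hence pointwise. With
   alpha_ij the coefficient of x^(nu_j - 1) in A_ij, subtracting
   sum_j alpha_ij Q^(II,j) from x phi_i brings it back into the span of the
   phi_k, and Q^(II,j) is orthogonal to the psi_k, so
     x phi_i = sum_j alpha_ij Q^(II,j) + sum_k <x phi_i, psi_k> phi_k,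
   while Q^(I,j) = sum_i alpha_ij psi_i. Multiplying by psi_i(y), summing over i,
   and subtracting the same identity with the two systems exchanged, the double
   sums cancel because <x phi_i, psi_k> = <phi_i, x psi_k>. *)
Require Import Defs.
From mathcomp Require Import all_boot all_order all_algebra.
From mathcomp Require Import all_classical all_reals all_analysis.

Import Order.TTheory GRing.Theory Num.Theory.
(* all_algebra shadows [form]. *)
Import Defs.

Local Open Scope classical_set_scope.
Local Open Scope ring_scope.

(** * The pairing on L^2 as a real-valued bilinear form *)

Section RealPairing.
Context {R : realType}.
Implicit Types f g h : R -> R.

(** [fine] sends infinite values to 0; [pairingE] guarantees that nothing is lost on L^2. *)
Definition ip f g : R := fine (pairing f g).

Lemma integrable_L2M f g : L2 f -> L2 g ->
  (leb R).-integrable setT (EFin \o (f \* g)).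
Proof. by move=> f2 g2; apply/Lfun1_integrable/Lfun2_mul_Lfun1. Qed.

Lemma pairingE f g : L2 f -> L2 g -> pairing f g = (ip f g)%:E.
Proof.
by move=> f2 g2; rewrite fineK//; apply/integrable_fin_num => //;
  exact: integrable_L2M.
Qed.

Lemma ipC f g : ip f g = ip g f.
Proof.
by congr fine; apply: eq_integral => x _; rewrite mulrC.
Qed.

Lemma ipB f g h : L2 f -> L2 g -> L2 h ->
  ip (fun x => f x - g x) h = ip f h - ip g h.
Proof.
move=> f2 g2 h2; have p1 : (1 <= 2%:E :> \bar R)%E by rewrite lee1n.
apply: EFin_inj; rewrite EFinB -!pairingE//; last first.
  by move: f2 g2; rewrite /L2/= => f2 g2; exact: rpredB f2 g2.
rewrite /pairing; under eq_integral do rewrite mulrBl.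
by rewrite integralB_EFin//; exact: integrable_L2M.
Qed.

Lemma L2_lincomb n (c : 'I_n -> R) (b : 'I_n -> R -> R) :
  (forall i, L2 (b i)) -> L2 (lincomb c b).
Proof.
move=> b2; have -> : lincomb c b = \sum_(i < n) c i *: b i.
  by apply/funext => x; rewrite fct_sumE; apply: eq_bigr.
have p1 : (1 <= 2%:E :> \bar R)%E by rewrite lee1n.
by rewrite /L2/=; apply: rpred_sum => i _; apply: rpredZ; exact: b2.
Qed.

Lemma ip_lincomb n (c : 'I_n -> R) (b : 'I_n -> R -> R) g :
  (forall i, L2 (b i)) -> L2 g ->
  ip (lincomb c b) g = \sum_(i < n) c i * ip (b i) g.
Proof.
move=> b2 g2; apply: EFin_inj; rewrite -pairingE//; last exact: L2_lincomb.
rewrite -sumEFin /pairing.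
under eq_integral do rewrite /lincomb mulr_suml -sumEFin.
rewrite integral_sum//; last first.
  move=> i; have := integrable_L2M (b i) g (b2 i) g2.
  move=> /(integrableZl measurableT (c i)); apply: eq_integrable => // x _.
  by rewrite /= -EFinM mulrA.
apply: eq_bigr => i _; rewrite EFinM -pairingE// -integralZl//; last first.
  exact: integrable_L2M.
by apply: eq_integral => x _; rewrite -EFinM mulrA.
Qed.

End RealPairing.

(** * Forms of polynomial tuples and their monomial coefficients *)

Section PolynomialTuples.
Context {R : realType} {r : nat}.
Implicit Types (P Q : 'I_r -> {poly R}) (u : 'I_r -> R -> R) (nu : 'I_r -> nat).

Lemma form_lincomb n (c : 'I_n -> R) (A : 'I_n -> 'I_r -> {poly R}) u :
  form (fun l => \sum_(i < n) c i *: A i l) u = lincomb c (fun i => form (A i) u).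
Proof.
apply/funext => x; rewrite /form /lincomb.
under eq_bigr do rewrite horner_sum mulr_suml.
rewrite exchange_big; apply: eq_bigr => i _; rewrite mulr_sumr.
by apply: eq_bigr => l _; rewrite hornerZ mulrA.
Qed.

Lemma form_monomial (l : 'I_r) (a : nat) u :
  form (fun k => (k == l)%:R *: 'X^a) u = (fun x => x ^+ a * u l x).
Proof.
apply/funext => x; rewrite /form (bigD1 l)//= big1 => [|k /negPf ->].
  by rewrite eqxx scale1r hornerXn addr0.
by rewrite scale0r horner0 mul0r.
Qed.

Lemma form_mulX P u x : form (fun l => 'X * P l) u x = x * form P u x.
Proof.
by rewrite /form mulr_sumr; apply: eq_bigr => l _; rewrite hornerM hornerX mulrA.
Qed.

Lemma formB P Q u :
  form (fun l => P l - Q l) u = (fun x => form P u x - form Q u x).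
Proof.
apply/funext => x; rewrite /form -sumrB; apply: eq_bigr => l _.
by rewrite hornerD hornerN mulrBl.
Qed.

Lemma size_scale_sum n (c : 'I_n -> R) (p : 'I_n -> {poly R}) N :
  (forall i, (size (p i) <= N)%N) -> (size (\sum_(i < n) c i *: p i)%R <= N)%N.
Proof.
move=> sp; apply: leq_trans (size_sum _ _ _) _; apply/bigmax_leqP => i _.
exact: leq_trans (size_scale_leq _ _) _.
Qed.

Lemma size_monomial_tuple (l : 'I_r) (a : nat) (k : 'I_r) :
  (size ((k == l)%:R *: 'X^a : {poly R}) <= (k == l) * a.+1)%N.
Proof.
case: eqP => _; last by rewrite scale0r size_poly0.
by rewrite scale1r size_polyXn mul1n.
Qed.

Definition L2_monomials u nu :=
  forall l (a : nat), (a < nu l)%N -> L2 (fun x => x ^+ a * u l x).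

(** Padding with zero coefficients up to [nu l] fixes the index range independently of the degrees.
    The outer coefficients 1 give a nested [lincomb], so linearity lemmas apply twice. *)
Lemma form_wide P u nu : (forall l, (size (P l) <= nu l)%N) ->
  form P u = lincomb (fun=> 1) (fun l =>
    lincomb (fun a : 'I_(nu l) => (P l)`_a) (fun a x => x ^+ a * u l x)).
Proof.
move=> sP; apply/funext => x; rewrite /form /lincomb; apply: eq_bigr => l _.
rewrite mul1r (horner_coef_wide _ (sP l)) mulr_suml.
by apply: eq_bigr => a _; rewrite mulrA.
Qed.

Lemma L2_form P u nu : L2_monomials u nu -> (forall l, (size (P l) <= nu l)%N) ->
  L2 (form P u).
Proof.
move=> u2 sP; rewrite (form_wide _ _ _ sP).
by apply: L2_lincomb => l; apply: L2_lincomb => a; exact: u2.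
Qed.

Lemma ip_form P u nu g :
  L2_monomials u nu -> (forall l, (size (P l) <= nu l)%N) -> L2 g ->
  ip (form P u) g =
    \sum_l \sum_(a < nu l) (P l)`_a * ip (fun x => x ^+ a * u l x) g.
Proof.
move=> u2 sP g2; rewrite (form_wide _ _ _ sP) ip_lincomb//; last first.
  by move=> l; apply: L2_lincomb => a; exact: u2.
apply: eq_bigr => l _; rewrite mul1r ip_lincomb// => a; exact: u2.
Qed.

End PolynomialTuples.

(** * Multi-index arithmetic *)

(** The pairs (l, a) with a < [nu l] label the monomials x^a u_l; numbering them by ['I_n] is what
    makes the coefficient matrix square. *)
Lemma mi_size_enum {r n : nat} (nu : 'I_r -> nat) : mi_size nu = n ->
  exists t : 'I_n -> {l : 'I_r & 'I_(nu l)}, bijective t.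
Proof.
move=> <-; have e : mi_size nu = #|{: {l : 'I_r & 'I_(nu l)}}|.
  rewrite card_tagged sumnE big_map big_enum/=.
  by apply: eq_bigr => l _; rewrite card_ord.
exists (fun i => enum_val (cast_ord e i)).
exists (fun z => cast_ord (esym e) (enum_rank z)) => z.
  by rewrite enum_valK cast_ordK.
by rewrite cast_ordKV enum_rankK.
Qed.

Lemma mi_size_incr {r : nat} (nu : 'I_r -> nat) j :
  mi_size (mi_incr nu j) = (mi_size nu + 1)%N.
Proof.
rewrite /mi_size /mi_incr big_split/=; congr addn.
by rewrite (bigD1 j)//= eqxx big1// => i /negPf ->.
Qed.

Lemma mi_decrK {r : nat} (nu : 'I_r -> nat) j :
  (0 < nu j)%N -> mi_incr (mi_decr nu j) j = nu.
Proof.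
move=> nuj; apply/funext => l; rewrite /mi_incr /mi_decr.
by case: eqP => [->|_]; rewrite ?subnK// subn0 addn0.
Qed.

(** * Biorthogonal systems of polynomial tuples and expansions in them *)

(** The data are symmetric in the two sides, so each result also yields its mirror image. The L^2
    bounds include the exponent [nu l] itself because multiplication by x raises degrees by one. *)
Record biorthogonal_system {R : realType} {r s : nat} (u : 'I_r -> R -> R)
    (v : 'I_s -> R -> R) (nu : 'I_r -> nat) (mu : 'I_s -> nat) (n : nat)
    (A : 'I_n -> 'I_r -> {poly R}) (B : 'I_n -> 'I_s -> {poly R}) : Prop :=
  BiorthogonalSystem {
    bs_nu : mi_size nu = n;
    bs_mu : mi_size mu = n;
    bs_nu_gt0 : forall l, (0 < nu l)%N;
    bs_mu_gt0 : forall l, (0 < mu l)%N;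
    bs_u : forall l a, (a <= nu l)%N -> L2 (fun x => x ^+ a * u l x);
    bs_v : forall l a, (a <= mu l)%N -> L2 (fun x => x ^+ a * v l x);
    bs_A : forall i l, (size (A i l) <= nu l)%N;
    bs_B : forall i l, (size (B i l) <= mu l)%N;
    bs_ip : forall i j, ip (form (A i) u) (form (B j) v) = (i == j)%:R }.

Arguments bs_nu {R r s u v nu mu n A B}.
Arguments bs_mu {R r s u v nu mu n A B}.
Arguments bs_nu_gt0 {R r s u v nu mu n A B}.
Arguments bs_mu_gt0 {R r s u v nu mu n A B}.
Arguments bs_u {R r s u v nu mu n A B}.
Arguments bs_v {R r s u v nu mu n A B}.
Arguments bs_A {R r s u v nu mu n A B}.
Arguments bs_B {R r s u v nu mu n A B}.
Arguments bs_ip {R r s u v nu mu n A B}.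

Lemma biorthogonal_system_sym {R : realType} {r s : nat} (u : 'I_r -> R -> R)
    (v : 'I_s -> R -> R) (nu : 'I_r -> nat) (mu : 'I_s -> nat) (n : nat)
    (A : 'I_n -> 'I_r -> {poly R}) (B : 'I_n -> 'I_s -> {poly R}) :
  biorthogonal_system u v nu mu n A B -> biorthogonal_system v u mu nu n B A.
Proof. by case=> *; split => // i j; rewrite ipC eq_sym. Qed.

Arguments biorthogonal_system_sym {R r s u v nu mu n A B}.

Section BiorthogonalSystem.
Context {R : realType} {r s : nat} {u : 'I_r -> R -> R} {v : 'I_s -> R -> R}
  {nu : 'I_r -> nat} {mu : 'I_s -> nat} {n : nat}
  {A : 'I_n -> 'I_r -> {poly R}} {B : 'I_n -> 'I_s -> {poly R}}.
Context (AB : biorthogonal_system u v nu mu n A B).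

Let phi i := form (A i) u.
Let psi i := form (B i) v.

Let u2 : L2_monomials u nu.
Proof. by move=> l a /ltnW; apply: (bs_u AB). Qed.

Let v2 : L2_monomials v mu.
Proof. by move=> l a /ltnW; apply: (bs_v AB). Qed.

Let sA i l : (size (A i l) <= nu l)%N. Proof. exact: (bs_A AB). Qed.
Let sB i l : (size (B i l) <= mu l)%N. Proof. exact: (bs_B AB). Qed.

Let psi2 i : L2 (psi i). Proof. exact: (L2_form _ _ _ v2). Qed.

(* The coefficient matrix of the phi_i is square because |nu| = n, so its right
   inverse given by biorthogonality is also a left inverse. *)
Lemma monomial_expansion (l k : 'I_r) (a b : nat) : (a < nu l)%N -> (b < nu k)%N ->
  \sum_i ip (fun x => x ^+ a * u l x) (psi i) * (A i k)`_b =
  ((l == k) && (a == b))%:R.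
Proof.
have [t t_bij] := mi_size_enum nu (bs_nu AB).
pose C := \matrix_(i < n, z < n) (A i (tag (t z)))`_(tagged (t z)).
pose D := \matrix_(z < n, i < n)
  ip (fun x => x ^+ tagged (t z) * u (tag (t z)) x) (psi i).
have /mulmx1C/matrixP DC : C *m D = 1%:M.
  apply/matrixP => i j.
  rewrite !mxE -(bs_ip AB) (ip_form _ _ _ _ u2 (sA i) (psi2 j)).
  rewrite sig_big_dep (reindex t)/=; last exact: onW_bij.
  by apply: eq_bigr => z _; rewrite !mxE.
move=> al bk; have [t' tK t'K] := t_bij.
have := DC (t' (Tagged (fun l => 'I_(nu l)) (Ordinal al)))
           (t' (Tagged (fun l => 'I_(nu l)) (Ordinal bk))).
rewrite !mxE; under eq_bigr do rewrite !mxE !t'K/=.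
move=> ->; rewrite (inj_eq (can_inj t'K)); congr (_%:R).
(* Second components of tagged indices are compared after transport along the equality of the first
   ones; identifying [k] with [l] removes the transport. *)
rewrite eqE/= /tag_eq/=; case: eqP => //= e.
by subst k; rewrite tagged_asE.
Qed.

(** Coefficients of X^b are compared: once each pairing is expanded over the monomials of [P],
    [monomial_expansion] leaves only the term (k, a) = (l, b). *)
Lemma tuple_expansion (P : 'I_r -> {poly R}) (l : 'I_r) :
  (forall l, (size (P l) <= nu l)%N) ->
  P l = \sum_i ip (form P u) (psi i) *: A i l.
Proof.
move=> sP; apply/polyP => b; rewrite coef_sum.
under eq_bigr do rewrite coefZ.
have [nb|bn] := leqP (nu l) b.
  rewrite nth_default ?(leq_trans (sP l))// big1// => i _.
  by rewrite nth_default ?mulr0// (leq_trans (sA i l)).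
under eq_bigr do rewrite (ip_form _ _ _ _ u2 sP (psi2 _)) mulr_suml.
rewrite exchange_big (bigD1 l)//= [X in _ + X]big1 ?addr0 => [|k kl].
  under eq_bigr do rewrite mulr_suml.
  rewrite exchange_big (bigD1 (Ordinal bn))//= [X in _ + X]big1 ?addr0 => [|a ab].
    under eq_bigr do rewrite -mulrA.
    by rewrite -mulr_sumr monomial_expansion// !eqxx mulr1.
  under eq_bigr do rewrite -mulrA.
  by rewrite -mulr_sumr monomial_expansion// eqxx (negPf (ab : (a : nat) != b)) mulr0.
under eq_bigr do rewrite mulr_suml.
rewrite exchange_big big1// => a _.
under eq_bigr do rewrite -mulrA.
by rewrite -mulr_sumr monomial_expansion// (negPf kl) mulr0.
Qed.

Lemma form_expansion (P : 'I_r -> {poly R}) : (forall l, (size (P l) <= nu l)%N) ->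
  form P u = lincomb (fun i => ip (form P u) (psi i)) phi.
Proof.
move=> sP; rewrite -form_lincomb; congr form; apply/funext => l.
exact: tuple_expansion.
Qed.

End BiorthogonalSystem.

(** * Type I and type II forms expressed through a biorthogonal system *)

Section MixedForms.
Context {R : realType} {r s : nat} {u : 'I_r -> R -> R} {v : 'I_s -> R -> R}
  {nu : 'I_r -> nat} {mu : 'I_s -> nat} {n : nat}
  {A : 'I_n -> 'I_r -> {poly R}} {B : 'I_n -> 'I_s -> {poly R}}.
Context (AB : biorthogonal_system u v nu mu n A B).

Let phi i := form (A i) u.
Let psi i := form (B i) v.

Let u2 : L2_monomials u nu.
Proof. by move=> l a /ltnW; apply: (bs_u AB). Qed.

Let v2 : L2_monomials v mu.
Proof. by move=> l a /ltnW; apply: (bs_v AB). Qed.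

Let sA i l : (size (A i l) <= nu l)%N. Proof. exact: (bs_A AB). Qed.
Let sB i l : (size (B i l) <= mu l)%N. Proof. exact: (bs_B AB). Qed.

Let phi2 i : L2 (phi i). Proof. exact: (L2_form _ _ _ u2). Qed.
Let psi2 i : L2 (psi i). Proof. exact: (L2_form _ _ _ v2). Qed.

Let BA := biorthogonal_system_sym AB.

(** Each x^b v_k is the form of a monomial tuple, hence a combination of the [psi i] by the
    expansion in the exchanged system. *)
Lemma pairing_monomials_eq0 f : L2 f -> (forall i, ip f (psi i) = 0) ->
  forall (k : 'I_s) (b : nat), (b < mu k)%N ->
    pairing f (fun x => x ^+ b * v k x) = 0%E.
Proof.
move=> f2 f0 k b bk; rewrite pairingE//; last exact: v2.
have sm l : (size ((l == k)%:R *: 'X^b : {poly R}) <= mu l)%N.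
  apply: leq_trans (size_monomial_tuple _ _ _) _.
  by case: eqP => [->|_]; rewrite ?mul1n.
rewrite -(form_monomial k b v) ipC (form_expansion BA _ sm) ip_lincomb//.
by rewrite big1// => i _; rewrite [ip _ f]ipC f0 mulr0.
Qed.

Lemma ip_psi_eq0 f : L2 f ->
  (forall (k : 'I_s) (b : nat), (b < mu k)%N ->
    pairing f (fun x => x ^+ b * v k x) = 0%E) ->
  forall i, ip f (psi i) = 0.
Proof.
move=> f2 f0 i; rewrite ipC (ip_form _ _ _ _ v2 (sB i) f2).
apply: big1 => k _; apply: big1 => b _.
by rewrite ipC /ip f0//= mulr0.
Qed.

Let alpha i j := (A i j)`_(nu j).-1.

(** Orthogonality for nu - e_j and the normalization at exponent nu_j - 1 together prescribe the
    pairings with all n monomials, which will determine the form. *)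
Lemma type_I_monomials j P : type_I v u mu (mi_decr nu j) j P ->
  forall (l : 'I_r) (a : nat), (a < nu l)%N ->
  pairing (form P v) (fun x => x ^+ a * u l x) =
    ((l == j) && (a == (nu j).-1))%:R%:E.
Proof.
move=> [[_ _ P0] P1] l a al; have [lj|lj] := eqVneq l j => /=; last first.
  by rewrite P0// /mi_decr (negPf lj) subn0.
subst l; case: eqVneq => [->|aj].
  by rewrite -P1 /mi_decr eqxx subn1.
rewrite P0// /mi_decr eqxx subn1 ltn_neqAle aj/= -ltnS prednK//.
exact: leq_trans al.
Qed.

(** This is [monomial_expansion] read at the top exponent b = nu_j - 1, where the coefficients are
    [alpha i j]. It shows that the set described by [Q_I] is nonempty. *)
Lemma type_I_lincomb j :
  type_I v u mu (mi_decr nu j) j (fun l => \sum_i alpha i j *: B i l).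
Proof.
have nuj : (0 < nu j)%N by apply: (bs_nu_gt0 AB).
have E l a : (a < nu l)%N ->
    pairing (form (fun l => \sum_i alpha i j *: B i l) v) (fun x => x ^+ a * u l x) =
    ((l == j) && (a == (nu j).-1))%:R%:E.
  move=> al; rewrite form_lincomb pairingE; [|exact: L2_lincomb|exact: u2].
  rewrite ip_lincomb; [|by []|exact: u2]; congr EFin.
  rewrite -(monomial_expansion AB l j a _ al); last by rewrite prednK.
  by apply: eq_bigr => i _; rewrite mulrC ipC.
split; last by rewrite E /mi_decr eqxx subn1 ?eqxx// prednK.
split.
(* Since nu_j > 0 the truncated subtraction is genuine, so |nu - e_j| + 1 = |nu| = |mu|. *)
- rewrite -(mi_size_incr _ j) mi_decrK//.
  by rewrite (bs_nu AB) (bs_mu AB).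
- by move=> l; apply: size_scale_sum.
- move=> l a; rewrite /mi_decr => al; rewrite E; last first.
    exact: leq_trans al (leq_subr _ _).
  by case: eqP al => //= ->; rewrite subn1 ltn_neqAle => /andP[/negPf ->].
Qed.

(** Uniqueness of the type I form: any solution expands in the [psi i] with coefficients its
    pairings with the [phi i], and [type_I_monomials] reduces each of these to the top coefficient
    of [A i j]. *)
Lemma Q_I_lincomb j : Q_I v u mu (mi_decr nu j) j = lincomb (alpha^~ j) psi.
Proof.
rewrite /Q_I; set P := xget _ _.
have PI : type_I v u mu (mi_decr nu j) j P.
  by apply: xgetPex; eexists; exact: type_I_lincomb.
have sP : forall l, (size (P l) <= mu l)%N by case: PI => [[]].
rewrite (form_expansion BA _ sP); congr lincomb; apply/funext => i.
rewrite ipC (ip_form _ _ _ _ u2 (sA i)); last exact: L2_form v2 sP.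
have nuj : ((nu j).-1 < nu j)%N.
  by rewrite prednK//; apply: (bs_nu_gt0 AB).
have E l (a : 'I_(nu l)) : ip (fun x => x ^+ a * u l x) (form P v) =
    ((l == j) && (a == (nu j).-1 :> nat))%:R.
  by rewrite ipC /ip (type_I_monomials _ _ PI).
rewrite (bigD1 j)//= [X in _ + X]big1 ?addr0 => [|l lj]; last first.
  by rewrite big1// => a _; rewrite E (negPf lj) mulr0.
rewrite (bigD1 (Ordinal nuj))//= [X in _ + X]big1 ?addr0 => [|a aj].
  by rewrite (E j (Ordinal nuj)) !eqxx mulr1.
by rewrite E (negPf (aj : (a : nat) != _)) andbF mulr0.
Qed.

Lemma L2_monomials_incr j : L2_monomials u (mi_incr nu j).
Proof.
move=> l a; rewrite /mi_incr => al; apply: (bs_u AB).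
by rewrite -ltnS (leq_trans al)// -addn1 leq_add2l leq_b1.
Qed.

(** The witness is x^(nu_j) u_j minus its biorthogonal projection onto the span of the [phi i]. The
    subtracted tuple has degrees below nu_j in position j, so the leading term X^(nu_j) survives. *)
Lemma type_II_exists j : exists P, type_II u v (mi_incr nu j) mu j P.
Proof.
pose f x := x ^+ nu j * u j x.
have f2 : L2 f by apply: (bs_u AB).
pose P l := (l == j)%:R *: 'X^(nu j) - \sum_i ip f (psi i) *: A i l.
have sS l : (size (\sum_i ip f (psi i) *: A i l)%R <= nu l)%N.
  exact: size_scale_sum.
have Pj : P j = 'X^(nu j) - \sum_i ip f (psi i) *: A i j.
  by rewrite /P eqxx scale1r.
have ltX : (size (- (\sum_i ip f (psi i) *: A i j)) < size ('X^(nu j) : {poly R}))%N.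
  by rewrite size_polyN size_polyXn ltnS.
have szPj : size (P j) = mi_incr nu j j.
  by rewrite Pj size_polyDl// size_polyXn /mi_incr eqxx addn1.
have sP l : (size (P l) <= mi_incr nu j l)%N.
  have [->|lj] := eqVneq l j; first by rewrite szPj.
  by rewrite /P (negPf lj) scale0r sub0r size_polyN /mi_incr (negPf lj) addn0.
exists P; split => //; last first.
  by rewrite Pj monicE lead_coefDl// lead_coefXn.
split => //.
  by rewrite mi_size_incr (bs_nu AB) (bs_mu AB).
apply: pairing_monomials_eq0; first exact: L2_form (L2_monomials_incr j) sP.
move=> k; rewrite formB form_monomial form_lincomb ipB//; last exact: L2_lincomb.
rewrite ip_lincomb// (bigD1 k)//= (bs_ip AB) eqxx mulr1.
rewrite big1 ?addr0 ?subrr// => i ik.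
by rewrite (bs_ip AB) (negPf ik) mulr0.
Qed.

Lemma mulX_form i x : x * phi i x =
  \sum_j alpha i j * Q_II u v (mi_incr nu j) mu j x +
  \sum_k ip (fun x => x * phi i x) (psi k) * phi k x.
Proof.
pose P j := xget (fun=> 0) (type_II u v (mi_incr nu j) mu j).
have PII j : type_II u v (mi_incr nu j) mu j (P j).
  by apply: xgetPex; exact: type_II_exists.
have sP j l : (size (P j l) <= mi_incr nu j l)%N by case: (PII j) => [[]].
have P2 j : L2 (form (P j) u) by exact: L2_form (L2_monomials_incr j) (sP j).
have P0 j k : ip (form (P j) u) (psi k) = 0.
  by apply: ip_psi_eq0 => //; case: (PII j) => [[]].
pose S l := \sum_j alpha i j *: P j l.
pose D l := 'X * A i l - S l.
have sX l : (size ('X * A i l)%R <= (nu l).+1)%N.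
  by apply: leq_trans (size_polyMleq _ _) _; rewrite size_polyX; exact: sA.
have X2 : L2 (form (fun l => 'X * A i l) u).
  apply: L2_form sX => l a al; exact: (bs_u AB).
(* Component j is monic of degree nu_j, and any other component l has degree below nu_l. *)
have coefP j l : (P j l)`_(nu l) = (l == j)%:R.
  have [->|lj] := eqVneq l j.
    case: (PII j) => _ /monicP + szP; rewrite lead_coefE szP /mi_incr eqxx addn1.
    by [].
  by rewrite nth_default// (leq_trans (sP j l))// /mi_incr (negPf lj) addn0.
have sD l : (size (D l) <= nu l)%N.
  apply/leq_sizeP => b; rewrite leq_eqVlt => /predU1P[<-|lb].
    (* As nu_l > 0, the coefficient of X^(nu_l) in ['X * A i l] is [alpha i l], exactly the one
       contributed by [S l]. *)
    rewrite coefB coef_sum coefXM eqn0Ngt (bs_nu_gt0 AB)/=.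
    rewrite (bigD1 l)//= coefZ coefP eqxx mulr1 big1 ?addr0 ?subrr// => j jl.
    by rewrite coefZ coefP eq_sym (negPf jl) mulr0.
  rewrite nth_default// (leq_trans (size_polyD _ _))// geq_max size_polyN.
  rewrite (leq_trans (sX l))//= (leq_trans _ lb)//.
  apply: size_scale_sum => j; rewrite (leq_trans (sP j l))//.
  by rewrite /mi_incr -addn1 leq_add2l leq_b1.
have XE : form (fun l => 'X * A i l) u = (fun x => x * phi i x).
  by apply/funext => z; rewrite form_mulX.
have DE : form D u =
    (fun z => z * phi i z - lincomb (alpha i) (fun j => form (P j) u) z).
  by rewrite formB XE form_lincomb.
have := congr1 (@^~ x) (form_expansion AB _ sD).
rewrite DE /= => /eqP; rewrite subr_eq addrC => /eqP ->; congr (_ + _).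
(* The expansion coefficients of [D] equal those of x phi_i, since the type II part is orthogonal to
   every [psi k]. *)
apply: eq_bigr => k _; rewrite ipB//; [|by rewrite -XE|exact: L2_lincomb|exact: psi2].
rewrite ip_lincomb//; last exact: psi2.
by rewrite big1 ?subr0// => j _; rewrite P0 mulr0.
Qed.

End MixedForms.

(** * The Christoffel-Darboux identity for polynomial tuples *)

Section ChristoffelDarboux.
Context {R : realType} {r s : nat} {u : 'I_r -> R -> R} {v : 'I_s -> R -> R}
  {nu : 'I_r -> nat} {mu : 'I_s -> nat} {n : nat}
  {A : 'I_n -> 'I_r -> {poly R}} {B : 'I_n -> 'I_s -> {poly R}}.

Lemma christoffel_darboux x y : biorthogonal_system u v nu mu n A B ->
  (x - y) * \sum_i form (A i) u x * form (B i) v y =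
    \sum_j Q_II u v (mi_incr nu j) mu j x * Q_I v u mu (mi_decr nu j) j y
    - \sum_k Q_I u v nu (mi_decr mu k) k x * Q_II v u (mi_incr mu k) nu k y.
Proof.
move=> AB; have BA := biorthogonal_system_sym AB.
pose M i k := ip (fun z => z * form (A i) u z) (form (B k) v).
(* Multiplication by z is symmetric for the pairing, so both recurrences share the matrix [M] up to
   transposition. *)
have MC i k : ip (fun z => z * form (B k) v z) (form (A i) u) = M i k.
  by congr fine; apply: eq_integral => z _; rewrite mulrAC mulrC mulrA.
have Ex : x * \sum_i form (A i) u x * form (B i) v y =
    \sum_j Q_II u v (mi_incr nu j) mu j x * Q_I v u mu (mi_decr nu j) j y +
    \sum_i \sum_k M i k * form (A k) u x * form (B i) v y.
  rewrite mulr_sumr; under eq_bigr do rewrite mulrA (mulX_form AB) mulrDl !mulr_suml.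
  rewrite big_split/= exchange_big/=; congr (_ + _); apply: eq_bigr => j _.
  rewrite (Q_I_lincomb AB) /lincomb mulr_sumr; apply: eq_bigr => i _.
  by rewrite mulrAC mulrC.
have Ey : y * \sum_i form (A i) u x * form (B i) v y =
    \sum_k Q_I u v nu (mi_decr mu k) k x * Q_II v u (mi_incr mu k) nu k y +
    \sum_i \sum_k M i k * form (A k) u x * form (B i) v y.
  rewrite mulr_sumr.
  under eq_bigr do rewrite mulrCA (mulX_form BA) mulrDr !mulr_sumr.
  (* The second exchange makes the index of psi(y) the outer one, matching the double sum in
     [Ex]. *)
  rewrite big_split/= exchange_big/= [in X in _ + X]exchange_big/=.
  congr (_ + _); apply: eq_bigr => k _.
    rewrite (Q_I_lincomb BA) /lincomb mulr_suml; apply: eq_bigr => i _.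
    by rewrite mulrCA mulrA.
  by apply: eq_bigr => i _; rewrite MC mulrCA mulrA.
by rewrite mulrBl Ex Ey opprD addrACA subrr addr0.
Qed.

End ChristoffelDarboux.

(** * From biorthogonal bases to polynomial tuples *)

Lemma form_space_choice {R : realType} {r n : nat} (u : 'I_r -> R -> R)
    (nu : 'I_r -> nat) (f : 'I_n -> R -> R) :
  (forall i, form_space u nu (f i)) ->
  exists A : 'I_n -> 'I_r -> {poly R},
    forall i, (forall l, (size (A i l) <= nu l)%N) /\ form (A i) u = f i.
Proof.
move=> uf.
have /choice[A hA] i : exists P : 'I_r -> {poly R},
    (forall l, (size (P l) <= nu l)%N) /\ form P u = f i.
  by have [P sP fP] := uf i; exists P.
by exists A.
Qed.

Theorem corollary5p1 (R : realType) (p q : nat) (hp : (1 <= p)%N) (hq : (1 <= q)%N)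
    (w1 : 'I_p -> R -> R) (w2 : 'I_q -> R -> R)
    (hw1 : forall k, weight (w1 k)) (hw2 : forall k, weight (w2 k))
    (nv : 'I_p -> nat) (mv : 'I_q -> nat)
    (hnv : forall k, (0 < nv k)%N) (hmv : forall k, (0 < mv k)%N)
    (n : nat) (hn : mi_size nv = n) (hm : mi_size mv = n)
    (hL2w1 : forall (k : 'I_p) (j : nat), (j <= nv k)%N ->
      L2 (fun x => x ^+ j * w1 k x))
    (hL2w2 : forall (k : 'I_q) (j : nat), (j <= mv k)%N ->
      L2 (fun x => x ^+ j * w2 k x))
    (hF : L2dim (form_space w1 nv) n) (hG : L2dim (form_space w2 mv) n)
    (hFG : forall f, (form_space w1 nv `&` perp (form_space w2 mv)) f ->
      L2eq f (fun=> 0))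
    (phi psi : 'I_n -> R -> R)
    (hphi : L2basis (form_space w1 nv) phi) (hpsi : L2basis (form_space w2 mv) psi)
    (hbi : biorthogonal phi psi)
    (K : R -> R -> R)
    (hK : forall x y, K x y = \sum_(j < n) phi j x * psi j y)
    (x y : R) :
  (x - y) * K x y =
    \sum_(j < p) Q_II w1 w2 (mi_incr nv j) mv j x * Q_I w2 w1 mv (mi_decr nv j) j y
    - \sum_(k < q) Q_I w1 w2 nv (mi_decr mv k) k x * Q_II w2 w1 (mi_incr mv k) nv k y.
Proof.
have [phiF _ _] := hphi; have [psiG _ _] := hpsi.
have [A hA] := form_space_choice _ _ _ phiF.
have [B hB] := form_space_choice _ _ _ psiG.
(* Membership in [form_space] is equality of functions, so the chosen tuples reproduce [phi] and
   [psi] at every point, not just almost everywhere. *)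
have AB : biorthogonal_system w1 w2 nv mv n A B.
  split => //; [by move=> i; case: (hA i)|by move=> i; case: (hB i)|].
  by move=> i j; rewrite (hA i).2 (hB j).2 /ip hbi.
rewrite hK -(christoffel_darboux _ _ AB); congr (_ * _).
by apply: eq_bigr => i _; rewrite (hA i).2 (hB i).2.
Qed.
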